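(* Let $n\ge 1$. Every $2$-local $\frac12$-derivation of the complex Lie algebra $\mathfrak{L}_{n,n+1}$ is a $\frac12$-derivation.
   Context: All algebras are over $\mathbb{C}$. A linear map $D:\mathfrak{L}\to\mathfrak{L}$ on a Lie algebra is a $\frac12$-derivation if $D[x,y]=\frac12\big([D(x),y]+[x,D(y)]\big)$ for all $x,y\in\mathfrak{L}$. A map $\nabla:\mathfrak{L}\to\mathfrak{L}$ (not necessarily linear) is a $2$-local $\frac12$-derivation if for all $x,y\in\mathfrak{L}$ there is a $\frac12$-derivation $D_{x,y}$ with $\nabla(x)=D_{x,y}(x)$ and $\nabla(y)=D_{x,y}(y)$. $\mathfrak{L}_{n,n+1}$ is the $(3n+2)$-dimensional solvable Lie algebra with basis $\{e_1,\dots,e_{2n+1},x_1,\dots,x_{n+1}\}$ and brackets, for $1\le i\le n$: $[e_{n+i},e_i]=e_{2n+1}$, $[e_i,x_i]=e_i$, $[e_{n+i},x_i]=-e_{n+i}$, $[e_i,x_{n+1}]=e_i$, and $[e_{2n+1},x_{n+1}]=e_{2n+1}$; brackets of basis elements not obtained from these by antisymmetry are zero. (Its nilradical is the Heisenberg algebra spanned by $e_1,\dots,e_{2n+1}$.) *)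

(* Defs.v *)
From HB Require Import structures.
From mathcomp Require Import all_boot all_order all_algebra.
From mathcomp Require Import ring.
From mathcomp Require Import reals complex.
Set Implicit Arguments. Unset Strict Implicit. Unset Printing Implicit Defensive.
Import Order.TTheory GRing.Theory Num.Theory.
Local Open Scope ring_scope.

HB.mixin Record isLieAlgebra (K : numFieldType) V of GRing.Lmodule K V := {
  lie : V -> V -> V;
  lie_linear_l : forall y : V, linear (lie^~ y);
  lie_linear_r : forall x : V, linear (lie x);
  lie_alt : forall x : V, lie x x = 0;
  lie_jacobi : forall x y z : V,
    lie x (lie y z) + lie y (lie z x) + lie z (lie x y) = 0
}.

#[short(type="lieAlgType")]
HB.structure Definition LieAlgebra (K : numFieldType) :=
  { V of GRing.Lmodule K V & isLieAlgebra K V }.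

Section HalfDerivations.
Variables (K : numFieldType) (L : lieAlgType K).

Definition half_derivation (D : L -> L) : Prop :=
  linear D /\
  forall x y : L, D (lie x y) = 2^-1 *: (lie (D x) y + lie x (D y)).

Definition two_local_half_derivation (nabla : L -> L) : Prop :=
  forall x y : L, exists D : L -> L,
    [/\ half_derivation D, nabla x = D x & nabla y = D y].

End HalfDerivations.

(* Coordinates are listed in the order e_1, ..., e_(2n+1), x_1, ..., x_(n+1).
   The ordinal i : 'I_n stands for the 1-based index i + 1. *)
Definition solvHeis (K : numFieldType) (n : nat) : Type :=
  'rV[K]_((n + n + 1) + (n + 1)).

HB.instance Definition _ (K : numFieldType) (n : nat) :=
  GRing.Lmodule.copy (solvHeis K n) 'rV[K]_((n + n + 1) + (n + 1)).

Section SolvHeis.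
Variables (K : numFieldType) (n : nat).
Local Notation idx := 'I_((n + n + 1) + (n + 1)).
Local Notation L := (solvHeis K n).

(* The column indices of e_i, e_(n+i), e_(2n+1), x_i and x_(n+1), respectively. *)
Definition pos_e (i : 'I_n) : idx := lshift (n + 1) (lshift 1 (lshift n i)).
Definition pos_f (i : 'I_n) : idx := lshift (n + 1) (lshift 1 (rshift n i)).
Definition pos_z : idx := lshift (n + 1) (rshift (n + n) ord0).
Definition pos_x (i : 'I_n) : idx := rshift (n + n + 1) (lshift 1 i).
Definition pos_y : idx := rshift (n + n + 1) (rshift n ord0).

Definition bvec (a : idx) : L := delta_mx 0 a.

Definition wedge (u v : L) (a b : idx) : K :=
  (u : 'rV_ _) 0 a * (v : 'rV_ _) 0 b - (u : 'rV_ _) 0 b * (v : 'rV_ _) 0 a.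

(* The alternating bilinear map with [e_(n+i), e_i] = e_(2n+1),
   [e_i, x_i] = e_i, [e_(n+i), x_i] = - e_(n+i), [e_i, x_(n+1)] = e_i and
   [e_(2n+1), x_(n+1)] = e_(2n+1): each listed bracket [b_p, b_q] = w
   contributes (u_p v_q - u_q v_p) w; see the lemmas lie_* below. *)
Definition bracket (u v : L) : L :=
  \sum_(i < n) (wedge u v (pos_f i) (pos_e i) *: bvec pos_z
              + wedge u v (pos_e i) (pos_x i) *: bvec (pos_e i)
              + wedge u v (pos_f i) (pos_x i) *: (- bvec (pos_f i))
              + wedge u v (pos_e i) pos_y *: bvec (pos_e i))
  + wedge u v pos_z pos_y *: bvec pos_z.

Lemma wedge_linear_l v a b : linear_for *%R (fun u => wedge u v a b).
Proof. by move=> c u u'; rewrite /wedge !mxE; ring. Qed.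

Lemma wedgeC u v a b : wedge u v a b = - wedge v u a b.
Proof. by rewrite /wedge; ring. Qed.

Lemma bracket_linear_l v : linear (bracket^~ v).
Proof.
move=> c u u'; rewrite /bracket /= scalerDr scaler_sumr addrACA -big_split /=.
congr (_ + _); last by rewrite wedge_linear_l scalerDl scalerA.
by apply: eq_bigr => i _; apply/rowP => k; rewrite !wedge_linear_l !mxE; ring.
Qed.

Lemma bracketC u v : bracket u v = - bracket v u.
Proof.
rewrite /bracket opprD -sumrN; congr (_ + _); last by rewrite wedgeC scaleNr.
by apply: eq_bigr => i _; rewrite !opprD -!scaleNr -!wedgeC.
Qed.

Lemma bracket_linear_r u : linear (bracket u).
Proof.
move=> c v v'; rewrite bracketC bracket_linear_l opprD -scalerN.
by rewrite -!(bracketC u).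
Qed.

Lemma bracket_alt u : bracket u u = 0.
Proof.
have w0 a b : wedge u u a b = 0 by rewrite /wedge; ring.
rewrite /bracket w0 scale0r addr0 big1 // => i _.
by rewrite !w0 !scale0r !addr0.
Qed.

Let eqE := (eq_lshift, eq_rshift, eq_lrshift, eq_rlshift).

Lemma idx_cases (P : idx -> Prop) :
  (forall i, P (pos_e i)) -> (forall i, P (pos_f i)) -> P pos_z ->
  (forall i, P (pos_x i)) -> P pos_y -> forall a, P a.
Proof.
move=> he hf hz hx hy a; rewrite -(splitK a); case: (split a) => b /=.
  rewrite -(splitK b); case: (split b) => c /=; last by rewrite (ord1 c).
  by rewrite -(splitK c); case: (split c).
by rewrite -(splitK b); case: (split b) => //= c; rewrite (ord1 c).
Qed.

Let bracketE u v a : (bracket u v : 'rV_ _) 0 a =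
  \sum_(i < n) (wedge u v (pos_f i) (pos_e i) * (a == pos_z)%:R
              + wedge u v (pos_e i) (pos_x i) * (a == pos_e i)%:R
              - wedge u v (pos_f i) (pos_x i) * (a == pos_f i)%:R
              + wedge u v (pos_e i) pos_y * (a == pos_e i)%:R)
  + wedge u v pos_z pos_y * (a == pos_z)%:R.
Proof.
rewrite !mxE summxE; congr (_ + _).
by apply: eq_bigr => i _; rewrite !mxE /= mulrN.
Qed.

Lemma bracket_e u v i : (bracket u v : 'rV_ _) 0 (pos_e i) =
  wedge u v (pos_e i) (pos_x i) + wedge u v (pos_e i) pos_y.
Proof.
rewrite bracketE (bigD1 i) //= big1 => [|j ji]; rewrite !eqE ?eqxx /=; first by ring.
by rewrite (eq_sym i) (negPf ji) /=; ring.
Qed.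

Lemma bracket_f u v i : (bracket u v : 'rV_ _) 0 (pos_f i) =
  - wedge u v (pos_f i) (pos_x i).
Proof.
rewrite bracketE (bigD1 i) //= big1 => [|j ji]; rewrite !eqE ?eqxx /=; first by ring.
by rewrite (eq_sym i) (negPf ji) /=; ring.
Qed.

Lemma bracket_z u v : (bracket u v : 'rV_ _) 0 pos_z =
  \sum_(i < n) wedge u v (pos_f i) (pos_e i) + wedge u v pos_z pos_y.
Proof.
rewrite bracketE eqxx mulr1; congr (_ + _).
by apply: eq_bigr => i _; rewrite !eqE /=; ring.
Qed.

Lemma bracket_x u v i : (bracket u v : 'rV_ _) 0 (pos_x i) = 0.
Proof. by rewrite bracketE big1 => [|j _]; rewrite !eqE /=; ring. Qed.

Lemma bracket_y u v : (bracket u v : 'rV_ _) 0 pos_y = 0.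
Proof. by rewrite bracketE big1 => [|j _]; rewrite !eqE /=; ring. Qed.

Let bracket2_z u v w : (bracket u (bracket v w) : 'rV_ _) 0 pos_z =
  \sum_(i < n) ((u : 'rV_ _) 0 (pos_f i) * (wedge v w (pos_e i) (pos_x i) +
                  wedge v w (pos_e i) pos_y)
      + (u : 'rV_ _) 0 (pos_e i) * wedge v w (pos_f i) (pos_x i)
      - (u : 'rV_ _) 0 pos_y * wedge v w (pos_f i) (pos_e i))
  - (u : 'rV_ _) 0 pos_y * wedge v w pos_z pos_y.
Proof.
rewrite bracket_z {2}/wedge bracket_z bracket_y mulr0 sub0r mulrDr opprD.
rewrite addrA; congr (_ + _); rewrite mulr_sumr -sumrB; apply: eq_bigr => i _.
by rewrite {1}/wedge bracket_f bracket_e; ring.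
Qed.

Lemma bracket_jacobi u v w :
  bracket u (bracket v w) + bracket v (bracket w u) + bracket w (bracket u v)
  = 0.
Proof.
have addE (p q r : L) a : ((p + q + r : L) : 'rV_ _) 0 a =
  (p : 'rV_ _) 0 a + (q : 'rV_ _) 0 a + (r : 'rV_ _) 0 a by rewrite !mxE.
apply/rowP; elim/idx_cases => [i|i||i|]; rewrite addE [RHS]mxE.
- rewrite !bracket_e /wedge !(bracket_e, bracket_x, bracket_y) /wedge; ring.
- rewrite !bracket_f /wedge !(bracket_f, bracket_x, bracket_y) /wedge; ring.
- rewrite !bracket2_z [X in X + _]addrACA -big_split addrACA -big_split /= big1.
    by rewrite /wedge; ring.
  by move=> i _; rewrite /wedge; ring.
- by rewrite !bracket_x !addr0.
- by rewrite !bracket_y !addr0.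
Qed.

HB.instance Definition _ :=
  isLieAlgebra.Build K L bracket_linear_l bracket_linear_r
    bracket_alt bracket_jacobi.

Local Notation br := (@lie K L).

Let wedge_bvec a b c d : wedge (bvec a) (bvec b) c d =
  (c == a)%:R * (d == b)%:R - (d == a)%:R * (c == b)%:R.
Proof. by rewrite /wedge !mxE !eqxx. Qed.

Let bvecE a b : (bvec a : 'rV_ _) 0 b = (b == a)%:R.
Proof. by rewrite mxE eqxx. Qed.

Let scale_bvecE (c : K) a b : (c *: bvec a : 'rV_ _) 0 b = c * (b == a)%:R.
Proof. by rewrite mxE bvecE. Qed.

Let oppE (u : L) b : (- u : 'rV_ _) 0 b = - (u : 'rV_ _) 0 b.
Proof. by rewrite mxE. Qed.

Let zeroE b : (0 : 'rV[K]_((n + n + 1) + (n + 1))) 0 b = 0.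
Proof. by rewrite mxE. Qed.

Let falseE : false%:R = 0 :> K. Proof. by []. Qed.

Local Ltac table :=
  apply/rowP; elim/idx_cases => [k|k||k|];
  rewrite /lie /= ?(bracket_e, bracket_f, bracket_z, bracket_x, bracket_y)
    ?(zeroE, oppE, scale_bvecE, bvecE, wedge_bvec) ?eqE ?eqxx /= ?falseE.
Local Ltac nosum := rewrite big1 => [|k _]; rewrite ?wedge_bvec ?eqE /= ?falseE; ring.

Lemma lie_ee i j : br (bvec (pos_e i)) (bvec (pos_e j)) = 0.
Proof. by table; try ring; nosum. Qed.

Lemma lie_ff i j : br (bvec (pos_f i)) (bvec (pos_f j)) = 0.
Proof. by table; try ring; nosum. Qed.

Lemma lie_fe i j : br (bvec (pos_f i)) (bvec (pos_e j)) = (i == j)%:R *: bvec pos_z.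
Proof.
table; try ring.
rewrite (bigD1 i) //= big1 => [|k /negPf ki]; rewrite !wedge_bvec !eqE ?ki ?eqxx /=; ring. Qed.

Lemma lie_ez i : br (bvec (pos_e i)) (bvec pos_z) = 0.
Proof. by table; try ring; nosum. Qed.

Lemma lie_fz i : br (bvec (pos_f i)) (bvec pos_z) = 0.
Proof. by table; try ring; nosum. Qed.

Lemma lie_ex i j : br (bvec (pos_e i)) (bvec (pos_x j)) = (i == j)%:R *: bvec (pos_e i).
Proof. by table; (try nosum); (try case: (eqVneq k i) => [->|_]); rewrite ?falseE; ring. Qed.

Lemma lie_fx i j :
  br (bvec (pos_f i)) (bvec (pos_x j)) = - ((i == j)%:R *: bvec (pos_f i)).
Proof. by table; (try nosum); (try case: (eqVneq k i) => [->|_]); rewrite ?falseE; ring. Qed.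

Lemma lie_ey i : br (bvec (pos_e i)) (bvec pos_y) = bvec (pos_e i).
Proof. by table; try ring; nosum. Qed.

Lemma lie_fy i : br (bvec (pos_f i)) (bvec pos_y) = 0.
Proof. by table; try ring; nosum. Qed.

Lemma lie_zx i : br (bvec pos_z) (bvec (pos_x i)) = 0.
Proof. by table; try ring; nosum. Qed.

Lemma lie_zy : br (bvec pos_z) (bvec pos_y) = bvec pos_z.
Proof. by table; try ring; nosum. Qed.

Lemma lie_xx i j : br (bvec (pos_x i)) (bvec (pos_x j)) = 0.
Proof. by table; try ring; nosum. Qed.

Lemma lie_xy i : br (bvec (pos_x i)) (bvec pos_y) = 0.
Proof. by table; try ring; nosum. Qed.

End SolvHeis.

(* Main.v *)
Require Import Defs.
From HB Require Import structures.
From mathcomp Require Import all_boot all_order all_algebra.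
From mathcomp Require Import ring.
From mathcomp Require Import reals complex.
Set Implicit Arguments. Unset Strict Implicit. Unset Printing Implicit Defensive.
Import Order.TTheory GRing.Theory Num.Theory.
Local Open Scope ring_scope.

(** The key fact is rigidity: a 1/2-derivation of the algebra is determined by
    its value at the single vector [x_(n+1)], written [y] below, with [f_i] for
    [e_(n+i)] and [z] for [e_(2n+1)].  Given this, let [nabla] be a 2-local
    1/2-derivation and [D0] a 1/2-derivation with [nabla y = D0 y].  For every
    [u] some 1/2-derivation [D] agrees with [nabla] at [u] and at [y]; then
    [D y = D0 y], so [D = D0] and [nabla u = D0 u].  Hence [nabla = D0]
    ([two_local_of_rigid]).

    Rigidity says that a 1/2-derivation [D] with [D y = 0] vanishes
    ([half_derivation_eq0]).  Such a [D] doubles the eigenvalues of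
    [u |-> [u, y]], which are 1 on the [e_i] and [z], and 0 on the [f_i], the
    [x_i] and [y].  As 2 is not an eigenvalue, [D] kills all [e_i] and [z].
    Since [[f_i, e_j]] and [[x_i, e_j]] lie in their span, [D f_i] and [D x_i]
    commute with [y] and with every [e_j], that is, they are multiples of
    [y - x_1 - ... - x_n].  The multiple is 0 for [f_i], because [f_i], up to
    sign, is the bracket [[f_i, x_i]] and so [D f_i] has no [y]-component; and
    it is 0 for [x_i], because [[f_i, D x_i] = 2 D [f_i, x_i] = 0] forbids an
    [x_i]-component. *)

(** * Half-derivations of an arbitrary Lie algebra *)

Section Generalities.
Variables (K : numFieldType) (L : lieAlgType K).
Implicit Types (D : L -> L) (u v a : L).

Lemma lie0r u : lie u (0 : L) = 0.
Proof. by have := lie_linear_r u (-1) 0 0; rewrite scaler0 addr0 scaleN1r addNr. Qed.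

Lemma half_derivation0 D : half_derivation D -> D 0 = 0.
Proof. by case=> /(_ (-1) 0 0); rewrite scaler0 addr0 scaleN1r addNr. Qed.

Lemma half_derivationZ D c u : half_derivation D -> D (c *: u) = c *: D u.
Proof.
by move=> hD; case: (hD) => /(_ c u 0); rewrite (half_derivation0 hD) !addr0.
Qed.

Lemma half_derivationB D1 D2 :
  half_derivation D1 -> half_derivation D2 ->
  half_derivation (fun u => D1 u - D2 u).
Proof.
move=> [l1 d1] [l2 d2]; split=> [c u v|u v].
  by rewrite l1 l2 scalerBr opprD addrACA.
have lB (p q : L) : p - q = -1 *: q + p by rewrite scaleN1r addrC.
rewrite d1 d2 -scalerBr; congr (_ *: _); rewrite !lB.
have -> : lie (-1 *: D2 u + D1 u) v = -1 *: lie (D2 u) v + lie (D1 u) v.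
  exact: lie_linear_l.
by rewrite lie_linear_r scalerDr addrACA.
Qed.

(** The source of the doubling of eigenvalues: if [[u, a] = c u], then
    [[D u, a] = 2 c D u]. *)
Lemma half_derivation_lie_ker D a u :
  half_derivation D -> D a = 0 -> lie (D u) a = 2 *: D (lie u a).
Proof.
move=> [_ ->] ->; rewrite lie0r addr0 scalerA divff ?scale1r //.
by rewrite pnatr_eq0.
Qed.

(** The vector [a] serves as a base point: the witnesses attached to the pairs
    [(a, u)] all agree at [a], hence are one and the same map. *)
Lemma two_local_of_rigid (a : L) :
    (forall D, half_derivation D -> D a = 0 -> forall u, D u = 0) ->
  forall nabla : L -> L,
  two_local_half_derivation nabla -> half_derivation nabla.
Proof.
move=> rigid nabla loc; have [D0 [hD0 nD0 _]] := loc a a.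
have nablaE u : nabla u = D0 u.
  have [D [hD nDa nDu]] := loc a u; rewrite nDu; apply/subr0_eq.
  apply: (rigid _ (half_derivationB hD hD0)).
  by rewrite -nDa -nD0 subrr.
by case: hD0 => l0 d0; split=> [c u v|u v]; rewrite !nablaE ?l0 ?d0.
Qed.

End Generalities.

(** * Rigidity of the solvable extension of the Heisenberg algebra *)

Section SolvHeis.
Variables (K : numFieldType) (n : nat).
Local Notation idx := 'I_((n + n + 1) + (n + 1)).
Local Notation L := (solvHeis K n).
Local Notation e_ i := (bvec K (pos_e i)).
Local Notation f_ i := (bvec K (pos_f i)).
Local Notation x_ i := (bvec K (pos_x i)).
Local Notation z := (bvec K (pos_z n)).
Local Notation y := (bvec K (pos_y n)).
Local Notation coord w a := ((w : 'rV[K]_((n + n + 1) + (n + 1))) 0 a).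

Let eqE := (eq_lshift, eq_rshift, eq_lrshift, eq_rlshift).

Lemma wedge_bvecr (w : L) (a b c : idx) :
  wedge w (bvec K a) b c = coord w b * (c == a)%:R - coord w c * (b == a)%:R.
Proof. by rewrite /wedge !mxE. Qed.

Lemma lie_y_e (w : L) i : coord (lie w y) (pos_e i) = coord w (pos_e i).
Proof. by rewrite /lie /= bracket_e !wedge_bvecr !eqE /=; ring. Qed.

Lemma lie_y_f (w : L) i : coord (lie w y) (pos_f i) = 0.
Proof. by rewrite /lie /= bracket_f !wedge_bvecr !eqE /=; ring. Qed.

Lemma lie_y_z (w : L) : coord (lie w y) (pos_z n) = coord w (pos_z n).
Proof.
rewrite /lie /= bracket_z big1 => [|i _]; rewrite !wedge_bvecr !eqE /=; ring.
Qed.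

Lemma lie_e_e (w : L) i :
  coord (lie w (e_ i)) (pos_e i) = - (coord w (pos_x i) + coord w (pos_y n)).
Proof. by rewrite /lie /= bracket_e !wedge_bvecr !eqE eqxx /=; ring. Qed.

Lemma lie_e_z (w : L) i : coord (lie w (e_ i)) (pos_z n) = coord w (pos_f i).
Proof.
rewrite /lie /= bracket_z (bigD1 i) //= big1 => [|j /negPf ji].
  by rewrite !wedge_bvecr !eqE eqxx /=; ring.
by rewrite !wedge_bvecr !eqE ji /=; ring.
Qed.

Lemma lie_f_f (w : L) i : coord (lie w (f_ i)) (pos_f i) = coord w (pos_x i).
Proof. by rewrite /lie /= bracket_f !wedge_bvecr !eqE eqxx /=; ring. Qed.

Lemma coord0 (a : idx) : coord (0 : L) a = 0.
Proof. by rewrite mxE. Qed.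

Lemma coordZ c (w : L) (a : idx) : coord (c *: w) a = c * coord w a.
Proof. by rewrite mxE. Qed.

(** In coordinates [w |-> [w, y]] is a diagonal projection: it keeps the
    [e_i]- and [z]-components and kills all the others. *)
Lemma lie_y_eigen2 (w : L) : lie w y = 2 *: w -> w = 0.
Proof.
move=> hw; have cw a : coord (lie w y) a = 2 * coord w a by rewrite hw coordZ.
have two0 (t : K) : 0 = 2 * t -> t = 0.
  by move/esym/eqP; rewrite mulf_eq0 pnatr_eq0 => /eqP.
have two1 (t : K) : t = 2 * t -> t = 0.
  by move/eqP; rewrite mulr2n mulrDl !mul1r -subr_eq0 opprD addrA subrr sub0r
    oppr_eq0 => /eqP.
apply/rowP; elim/idx_cases => [i|i||i|]; rewrite coord0.
- by apply: two1; rewrite -[LHS]lie_y_e cw.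
- by apply: two0; rewrite -cw lie_y_f.
- by apply: two1; rewrite -[LHS]lie_y_z cw.
- by apply: two0; rewrite -cw /lie /= bracket_x.
- by apply: two0; rewrite -cw /lie /= bracket_y.
Qed.

Lemma centralizer_e_coord_x (w : L) i :
  lie w (e_ i) = 0 -> coord w (pos_x i) = - coord w (pos_y n).
Proof.
move=> hw; apply/eqP; rewrite -addr_eq0 -oppr_eq0 -lie_e_e hw.
by rewrite coord0.
Qed.

(** The common centralizer of [y] and the [e_j] is the line through
    [y - x_1 - ... - x_n], on which the [y]-component is a coordinate. *)
Lemma centralizer_ye_eq0 (w : L) :
  lie w y = 0 -> (forall j, lie w (e_ j) = 0) -> coord w (pos_y n) = 0 -> w = 0.
Proof.
move=> wy we w0; apply/rowP; elim/idx_cases => [i|i||i|]; rewrite coord0 //.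
- by rewrite -lie_y_e wy coord0.
- by rewrite -(lie_e_z w) we coord0.
- by rewrite -lie_y_z wy coord0.
- by rewrite centralizer_e_coord_x ?w0 ?oppr0.
Qed.

Lemma half_derivation_eq0_basis (D : L -> L) :
  half_derivation D -> (forall a, D (bvec K a) = 0) -> forall u, D u = 0.
Proof.
move=> hD D0 u; have DD : {morph D : v w / v + w}.
  by move=> v w; have := hD.1 1 v w; rewrite !scale1r.
have -> : u = \sum_a coord u a *: bvec K a by exact: row_sum_delta.
rewrite (big_morph D DD (half_derivation0 hD)) big1 // => a _.
by rewrite (half_derivationZ _ _ hD) D0 scaler0.
Qed.

Lemma half_derivation_eq0 (D : L -> L) :
  half_derivation D -> D y = 0 -> forall u, D u = 0.
Proof.
move=> hD Dy; have D0 := half_derivation0 hD.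
have kerD := half_derivation_lie_ker _ hD.
have De i : D (e_ i) = 0 by apply: lie_y_eigen2; rewrite kerD // lie_ey.
have Dz : D z = 0 by apply: lie_y_eigen2; rewrite kerD // lie_zy.
have Df i : D (f_ i) = 0.
  apply: centralizer_ye_eq0 => [|j|].
  - by rewrite kerD // lie_fy D0 scaler0.
  - by rewrite kerD // lie_fe (half_derivationZ _ _ hD) Dz !scaler0.
  have -> : f_ i = -1 *: lie (f_ i) (x_ i).
    by rewrite lie_fx eqxx scale1r scaleN1r opprK.
  (* Brackets have no y-component, and D of a bracket is a sum of brackets. *)
  rewrite (half_derivationZ _ _ hD) hD.2 !coordZ [X in _ * (_ * X)]mxE.
  by rewrite /lie /= !bracket_y addr0 !mulr0.
have Dxe i j : D (lie (x_ i) (e_ j)) = 0.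
  have -> : lie (x_ i) (e_ j) = - (j == i)%:R *: e_ j.
    by rewrite scaleNr -lie_ex; apply: bracketC.
  by rewrite (half_derivationZ _ _ hD) De scaler0.
have xf i : lie (x_ i) (f_ i) = f_ i.
  have -> : lie (x_ i) (f_ i) = - lie (f_ i) (x_ i) by apply: bracketC.
  by rewrite lie_fx eqxx scale1r opprK.
have Dx i : D (x_ i) = 0.
  have Dx_e j : lie (D (x_ i)) (e_ j) = 0 by rewrite kerD // Dxe scaler0.
  apply: centralizer_ye_eq0 => //; first by rewrite kerD // lie_xy D0 scaler0.
  rewrite -[LHS]opprK -(centralizer_e_coord_x (Dx_e i)) -lie_f_f kerD //.
  by rewrite xf Df scaler0 coord0 oppr0.
by apply: half_derivation_eq0_basis => //; elim/idx_cases.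
Qed.

End SolvHeis.

Theorem theorem14 (R : realType) (n : nat) (hn : (1 <= n)%N)
    (nabla : solvHeis R[i] n -> solvHeis R[i] n) :
  two_local_half_derivation nabla -> half_derivation nabla.
Proof.
exact: (two_local_of_rigid (@half_derivation_eq0 _ n)).
Qed.
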